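(* Consider the finite-horizon Markov decision process and the optimality gap minimization problem (minimize $J(\pi)$ over policies $\pi$ subject to C2 and C3) defined in the context. Given the initial state $(\boldsymbol h_1,\boldsymbol b_1)$, the optimal value of the objective $J(\pi)$ in this problem equals $V_1(\boldsymbol h_1,\boldsymbol b_1)$, where the functions $V_t$ are computed recursively by the Bellman equation: for $1\le t\le T-1$, $$V_t(\boldsymbol h_t,\boldsymbol b_t)=\min_{\boldsymbol p_t\in\mathcal{P}_t}\left\{c(\boldsymbol h_t,\boldsymbol p_t)+\mathbb{E}\left[V_{t+1}(\boldsymbol h_{t+1},\boldsymbol b_{t+1})\mid \boldsymbol h_t,\boldsymbol b_t,\boldsymbol p_t\right]\right\},$$ with terminal condition $$V_T(\boldsymbol h_T,\boldsymbol b_T)=\min_{\boldsymbol p_T\in\mathcal{P}_T}c(\boldsymbol h_T,\boldsymbol p_T),$$ where $\mathcal{P}_t=\{\boldsymbol p_t\in\mathcal{P}:\ \sum_{n=1}^N\mathbf 1_{\{p_{n,t}>0\}}\le R,\ 0\le e_{n,t}\le b_{n,t}\ \forall n\in[N]\}$ is the feasible set of transmission power actions at time slot $t$.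
   Context: There are $N$ devices, $T$ time slots, and an integer $R<N$. $L,G,K,W,N_0,\sigma>0$ and, for each device $n$, $s_n,I_n,c_n,|\boldsymbol\xi_n|>0$ are constants. States. Device $n$ at slot $t$ has state $(h_{n,t},b_{n,t})\in\mathcal{H}\times\mathcal{B}$, where $\mathcal{H}=\{H_1<\dots<H_{N_h}\}$ is a finite set of positive channel gains and $\mathcal{B}$ is a finite set of battery levels in $[0,b^{\max}]$. The system state is $(\boldsymbol h_t,\boldsymbol b_t)\in\mathcal{H}^N\times\mathcal{B}^N$. Actions. $\boldsymbol p_t=(p_{1,t},\dots,p_{N,t})\in\mathcal{P}=\mathcal{P}_1\times\dots\times\mathcal{P}_N$, where $\mathcal{P}_n$ is a finite set of transmission powers of device $n$; $p_{n,t}=0$ means that device $n$ is idle. (The per-device sets in this product are distinct from the feasible set at slot $t$ defined in the claim.) Energy. The energy consumed by device $n$ at slot $t$ is $e_{n,t}=\mathbf 1_{\{p_{n,t}>0\}}K I_n^2c_n|\boldsymbol\xi_n|+\frac{p_{n,t}s_n}{r_{n,t}}$ with $r_{n,t}=W\log_2\left(1+\frac{p_{n,t}h_{n,t}}{N_0W}\right)$ (and $e_{n,t}=0$ if $p_{n,t}=0$). Transitions. The harvested energies $u_{n,t}$ are i.i.d. over $t$ with distribution $\mathbb{P}(U_n)$, and $b_{n,t+1}=\min\{b_{n,t}+u_{n,t}-e_{n,t},b^{\max}\}$. The channel of device $n$ is a homogeneous Markov chain with transition probabilities $\psi_n^{(i,j)}=\mathbb{P}(h_{n,t+1}=H_j\mid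 h_{n,t}=H_i)$. The transition probability factorizes as $\mathbb{P}(\boldsymbol h_{t+1},\boldsymbol b_{t+1}\mid\boldsymbol h_t,\boldsymbol b_t,\boldsymbol p_t)=\prod_{n=1}^N\mathbb{P}(h_{n,t+1}\mid h_{n,t})\,\mathbb{P}(b_{n,t+1}\mid h_{n,t},b_{n,t},p_{n,t})$, where $\mathbb{P}(b_{n,t+1}\mid h_{n,t},b_{n,t},p_{n,t})$ equals $\mathbb{P}(U_n=b_{n,t+1}-b_{n,t}+e_{n,t})$ if $b_{n,t+1}<b^{\max}$ and $\mathbb{P}(U_n\ge b^{\max}-b_{n,t}+e_{n,t})$ if $b_{n,t+1}=b^{\max}$. Cost. $c(\boldsymbol h_t,\boldsymbol p_t)=\sum_{n=1}^N c_n(h_{n,t},p_{n,t})$ with $c_n(h,p)=\frac{2LG^2\,q(h,p)}{N\sqrt{KT}}$ and $q(h,p)=1-\exp\left(-\frac{\sigma N_0W}{ph}\right)$ (value $1$ if $p=0$). Problem. A policy is $\pi=\{\pi_t:\mathcal{H}^N\times\mathcal{B}^N\to\mathcal{P}\}_{t=1}^T$, with $\boldsymbol p_t=\pi_t(\boldsymbol h_t,\boldsymbol b_t)$. Its expected cumulative cost is $J(\pi)=\mathbb{E}_\pi\left[\sum_{t=1}^Tc(\boldsymbol h_t,\boldsymbol p_t)\mid\boldsymbol h_1,\boldsymbol b_1\right]$. Constraints: C2: $0\le e_{n,t}\le b_{n,t}$ for all $n,t$; C3: $\sum_{n=1}^N\mathbf 1_{\{p_{n,t}>0\}}\le R$ for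 all $t$. *)

(* Defs.v *)
From HB Require Import structures.
From mathcomp Require Import all_boot all_order all_algebra.
From mathcomp Require Import finmap.
From mathcomp Require Import all_classical all_reals all_analysis.
Set Implicit Arguments.
Unset Strict Implicit.
Unset Printing Implicit Defensive.
Import Order.TTheory GRing.Theory Num.Theory.
Import numFieldNormedType.Exports.
Local Open Scope classical_set_scope.
Local Open Scope ring_scope.

(* Channel states are handled through their index i, the gain being H_i.
   The requirement that P_n contains 0 is what makes p = 0 ("idle") available
   to every device; it makes every feasible action set nonempty. *)
Record params (R : realType) := Params {
  numDev : nat;
  numSlots : nat;
  maxActive : nat;
  maxActive_lt : (maxActive < numDev)%N;
  numSlots_gt0 : (0 < numSlots)%N;
  cstL : R; cstL_gt0 : 0 < cstL;
  cstG : R; cstG_gt0 : 0 < cstG;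
  cstK : R; cstK_gt0 : 0 < cstK;
  cstW : R; cstW_gt0 : 0 < cstW;
  cstN0 : R; cstN0_gt0 : 0 < cstN0;
  cstSigma : R; cstSigma_gt0 : 0 < cstSigma;
  cstS : 'I_numDev -> R; cstS_gt0 : forall n, 0 < cstS n;
  cstI : 'I_numDev -> R; cstI_gt0 : forall n, 0 < cstI n;
  cstC : 'I_numDev -> R; cstC_gt0 : forall n, 0 < cstC n;
  (* |xi_n| *)
  normXi : 'I_numDev -> R; normXi_gt0 : forall n, 0 < normXi n;
  numGains : nat;
  gain : 'I_numGains -> R;
  gain_gt0 : forall i, 0 < gain i;
  gain_lt : forall i j : 'I_numGains, (i < j)%N -> gain i < gain j;
  bmax : R;
  batteries : {fset R};
  batteries_bound : forall b, b \in batteries -> 0 <= b <= bmax;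
  powers : 'I_numDev -> {fset R};
  powers_ge0 : forall n p, p \in powers n -> 0 <= p;
  powers_idle : forall n, 0 \in powers n;
  psi : 'I_numDev -> 'I_numGains -> 'I_numGains -> R;
  psi_ge0 : forall n i j, 0 <= psi n i j;
  psi_sum1 : forall n i, \sum_j psi n i j = 1;
  (* the law of U_n, a probability measure on the real line *)
  harvest : 'I_numDev -> probability (measurableTypeR R) R
}.

Section Model.
Context {R : realType}.
Variable m : params R.

Definition device := 'I_(numDev m).
(* The ordinal t stands for slot t + 1. *)
Definition slot := 'I_(numSlots m).
Definition first_slot : slot := Ordinal (numSlots_gt0 m).

Definition state : finType :=
  ({ffun device -> 'I_(numGains m)} * {ffun device -> batteries m})%type.
Definition action : finType := {dffun forall n : device, powers n}.

Definition channel (s : state) (n : device) : R := gain (s.1 n).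
Definition battery (s : state) (n : device) : R := val (s.2 n).
Definition power (p : action) (n : device) : R := val (p n).

Definition log2 (x : R) : R := ln x / ln 2.

Definition rate (h p : R) : R :=
  cstW m * log2 (1 + p * h / (cstN0 m * cstW m)).

Definition energy (n : device) (h p : R) : R :=
  if p == 0 then 0
  else (0 < p)%R%:R * (cstK m * cstI n ^+ 2 * cstC n * normXi n)
       + p * cstS n / rate h p.

Definition outage (h p : R) : R :=
  if p == 0 then 1
  else 1 - expR (- (cstSigma m * cstN0 m * cstW m / (p * h))).

Definition device_cost (h p : R) : R :=
  2 * cstL m * cstG m ^+ 2 * outage h p
  / ((numDev m)%:R * Num.sqrt (cstK m * (numSlots m)%:R)).

Definition cost (s : state) (p : action) : R :=
  \sum_(n : device) device_cost (channel s n) (power p n).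

Definition battery_kernel (n : device) (h b p b' : R) : R :=
  if b' < bmax m
  then fine (harvest n [set u | u = b' - b + energy n h p])
  else fine (harvest n [set u | bmax m - b + energy n h p <= u]).

Definition kernel (s : state) (p : action) (s' : state) : R :=
  \prod_(n : device)
    (psi n (s.1 n) (s'.1 n)
     * battery_kernel n (channel s n) (battery s n) (power p n) (battery s' n)).

(* The finite set of battery levels is a state space for the dynamics
   b' = min(b + U_n - e, bmax): it is left only with probability 0 as long as
   e <= b. Equivalently, battery_kernel is a probability on these levels. *)
Definition battery_closed : Prop :=
  forall (n : device) (i : 'I_(numGains m)) (b p : R),
    b \in batteries m -> p \in powers n ->
    0 <= energy n (gain i) p <= b ->
    {ae harvest n, forall u : R,
       Num.min (b + u - energy n (gain i) p) (bmax m) \in batteries m}.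

Definition constraintC2 (s : state) (p : action) : bool :=
  [forall n : device,
     0 <= energy n (channel s n) (power p n) <= battery s n].

Definition constraintC3 (p : action) : bool :=
  (\sum_(n : device) (0 < power p n)%R <= maxActive m)%N.

Definition feasible_actions (s : state) : {set action} :=
  [set p : action | constraintC3 p && constraintC2 s p]%SET.

Definition idle : action :=
  [ffun n : device => FSetSub (powers_idle n) : powers n].

Lemma idle_feasible (s : state) : idle \in feasible_actions s.
Proof.
have idle0 n : power idle n = 0 by rewrite /power /idle ffunE.
rewrite inE; apply/andP; split.
  by rewrite /constraintC3 big1// => n _; rewrite idle0 ltxx.
apply/forallP => n; rewrite idle0 /energy eqxx lexx /=.
by have /andP[] := batteries_bound (valP (s.2 n)).
Qed.

(* A minimum over the feasible actions; since idle is feasible, using its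
   value as the neutral element of the iterated minimum is harmless. *)
Definition min_feasible (s : state) (f : action -> R) : R :=
  \big[Num.min/f idle]_(p in feasible_actions s) f p.

(* E[V(h', b') | h, b, p] *)
Definition next_expectation (V : state -> R) (s : state) (p : action) : R :=
  \sum_(s' : state) kernel s p s' * V s'.

Definition policy := slot -> state -> action.
Definition trajectory := {ffun slot -> state}.

(* Probability of the move into w_t; for the first slot, the indicator of the
   prescribed initial state. For t > 0, ord_pred t is the slot t - 1. *)
Definition step_prob (pi : policy) (s1 : state) (w : trajectory) (t : slot) : R :=
  if t == first_slot then (w t == s1)%:R
  else kernel (w (ord_pred t)) (pi (ord_pred t) (w (ord_pred t))) (w t).

Definition history_prob (pi : policy) (s1 : state) (w : trajectory) (t : slot) : R :=
  \prod_(k : slot | (k <= t)%N) step_prob pi s1 w k.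

Definition trajectory_prob (pi : policy) (s1 : state) (w : trajectory) : R :=
  \prod_(k : slot) step_prob pi s1 w k.

Definition J (pi : policy) (s1 : state) : R :=
  \sum_(w : trajectory)
    trajectory_prob pi s1 w * \sum_(t : slot) cost (w t) (pi t (w t)).

(* C2 and C3 bear on the random process: they are required, at every slot, of
   every history that has positive probability. Histories, rather than complete
   trajectories, are used because an infeasible action could send the battery
   out of its finite set, hence give weight 0 to every continuation. *)
Definition admissible (s1 : state) (pi : policy) : Prop :=
  forall (w : trajectory) (t : slot), 0 < history_prob pi s1 w t ->
    constraintC2 (w t) (pi t (w t)) /\ constraintC3 (pi t (w t)).

Definition optimal_value (s1 : state) (v : R) : Prop :=
  (exists2 pi : policy, admissible s1 pi & J pi s1 = v) /\
  (forall pi : policy, admissible s1 pi -> v <= J pi s1).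

End Model.

(* Main.v *)
(* Where the actions are feasible the transition kernel is stochastic, because
   the next battery levels b' correspond to the fibers over b' of
   u |-> min(b + u - e, bmax), and this map stays in the battery set almost
   surely. For a policy feasible in every state, summing over the first state
   of a trajectory and inducting on the horizon then compares J with any sub- or
   super-solution of the policy's backward recursion: V is a subsolution for each
   such policy and a solution for the one choosing the Bellman minimizers. An
   admissible policy may be infeasible, but only in unreachable states; playing
   idle there changes neither the trajectory probabilities nor J. *)
Require Import Defs.
From mathcomp Require Import all_boot all_order all_algebra.
From mathcomp Require Import finmap.
From mathcomp Require Import lra measurable_realfun.
From mathcomp Require Import all_classical all_reals all_analysis.
Import Order.TTheory GRing.Theory Num.Theory.
Local Open Scope ring_scope.

(** * Paths as a first state followed by a shorter path *)

Definition ffun_cons {S : Type} {n : nat} (x : S) (w : {ffun 'I_n -> S}) :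
    {ffun 'I_n.+1 -> S} :=
  [ffun i => if unlift ord0 i is Some j then w j else x].

Lemma ffun_cons0 {S : Type} {n : nat} (x : S) (w : {ffun 'I_n -> S}) :
  ffun_cons x w ord0 = x.
Proof. by rewrite ffunE unlift_none. Qed.

Lemma ffun_consS {S : Type} {n : nat} (x : S) (w : {ffun 'I_n -> S}) (i : 'I_n) :
  ffun_cons x w (lift ord0 i) = w i.
Proof. by rewrite ffunE liftK. Qed.

Lemma sum_ffunS {R : nmodType} {S : finType} {n : nat}
    (F : {ffun 'I_n.+1 -> S} -> R) :
  \sum_w F w = \sum_x \sum_(w : {ffun 'I_n -> S}) F (ffun_cons x w).
Proof.
rewrite pair_big /=.
rewrite (reindex (fun p : S * {ffun 'I_n -> S} => ffun_cons p.1 p.2)) //=.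
exists (fun w => (w ord0, [ffun i => w (lift ord0 i)])) => [[x w]|w] _ /=.
  rewrite ffun_cons0; congr pair.
  by apply/ffunP => i; rewrite ffunE ffun_consS.
apply/ffunP => i; case: (unliftP ord0 i) => [j|] ->.
  by rewrite ffun_consS ffunE.
by rewrite ffun_cons0.
Qed.

Lemma sum_indicator {R : pzSemiRingType} {S : finType} (s : S) (F : S -> R) :
  \sum_x (s == x)%:R * F x = F s.
Proof.
rewrite (bigD1 s) //= eqxx mul1r big1 ?addr0 // => x xs.
by rewrite eq_sym (negPf xs) mul0r.
Qed.

(** * Expectations along a finite inhomogeneous Markov chain *)

(** [n] counts the moves, so a path has [n.+1] states and induction starts from a path with one
    state. This weighted sum over paths is an expectation once [K] is stochastic. *)
Definition chain_mean {R : comPzRingType} {S : finType} {n : nat}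
    (K : 'I_n -> S -> S -> R) (s : S) (G : {ffun 'I_n.+1 -> S} -> R) : R :=
  \sum_(w : {ffun 'I_n.+1 -> S}) (w ord0 == s)%:R
    * \prod_(i < n) K i (w (widen_ord (leqnSn n) i)) (w (lift ord0 i)) * G w.

Lemma chain_mean0 {R : comPzRingType} {S : finType} (K : 'I_0 -> S -> S -> R)
    (s : S) (G : {ffun 'I_1 -> S} -> R) :
  chain_mean K s G = G [ffun=> s].
Proof.
rewrite /chain_mean (bigD1 [ffun=> s]) //= [X in _ + X]big1 => [|w ws].
  by rewrite ffunE eqxx big_ord0 !mul1r addr0.
suff /negPf -> : w ord0 != s by rewrite !mul0r.
apply: contra ws => /eqP w0; apply/eqP/ffunP => i.
by rewrite ffunE (ord1 i).
Qed.

(** Conditioning on the first move: a path from [s] is [s] followed by a path from some [s'], and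
    summing the indicator of [s'] against [K ord0 s s'] restores the first factor of its weight. *)
Lemma chain_meanS {R : comPzRingType} {S : finType} {n : nat}
    (K : 'I_n.+1 -> S -> S -> R) (s : S) (G : {ffun 'I_n.+2 -> S} -> R) :
  chain_mean K s G =
  \sum_s' K ord0 s s' * chain_mean (fun i => K (lift ord0 i)) s'
                          (fun w => G (ffun_cons s w)).
Proof.
rewrite /chain_mean sum_ffunS.
under eq_bigr => x _.
  under eq_bigr => w _ do rewrite ffun_cons0 eq_sym -mulrA.
  rewrite -big_distrr /=.
  over.
rewrite sum_indicator.
under [RHS]eq_bigr => s' _ do rewrite big_distrr /=.
rewrite exchange_big /=; apply: eq_bigr => w _.
under [RHS]eq_bigr => s' _ do rewrite -mulrA mulrCA.
rewrite sum_indicator mulrA; congr (_ * _).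
rewrite big_ord_recl ffun_consS; congr (K _ _ _ * _).
  by rewrite (_ : widen_ord _ _ = ord0) ?ffun_cons0 //; apply: val_inj.
apply: eq_bigr => i _; rewrite ffun_consS.
rewrite (_ : widen_ord _ _ = lift ord0 (widen_ord (leqnSn n) i)) ?ffun_consS //.
exact: val_inj.
Qed.

Lemma chain_mean_cst_add {R : comPzRingType} {S : finType} {n : nat}
    (K : 'I_n -> S -> S -> R) (s : S) (a : R) (G : {ffun 'I_n.+1 -> S} -> R) :
  (forall i x, \sum_y K i x y = 1) ->
  chain_mean K s (fun w => a + G w) = a + chain_mean K s G.
Proof.
elim: n K s G => [|n IHn] K s G K1; first by rewrite !chain_mean0.
rewrite !chain_meanS.
under eq_bigr => s' _ do rewrite IHn // mulrDr.
by rewrite big_split /= -big_distrl /= K1 mul1r.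
Qed.

(** Subsolutions of the backward recursion bound the expected cost from below. Induction on the
    horizon: after the first move, the shifted [c] and [v] satisfy the same hypotheses. *)
Lemma le_chain_mean {R : numDomainType} {S : finType} {n : nat}
    (K : 'I_n -> S -> S -> R) (c v : 'I_n.+1 -> S -> R) (s : S) :
  (forall i x y, 0 <= K i x y) -> (forall i x, \sum_y K i x y = 1) ->
  (forall x, v ord_max x <= c ord_max x) ->
  (forall i x, v (widen_ord (leqnSn n) i) x <=
     c (widen_ord (leqnSn n) i) x + \sum_y K i x y * v (lift ord0 i) y) ->
  v ord0 s <= chain_mean K s (fun w => \sum_i c i (w i)).
Proof.
elim: n K c v s => [|n IHn] K c v s K0 K1 vlast vstep.
  rewrite chain_mean0 big_ord1 ffunE.
  by have := vlast s; rewrite (ord1 ord_max).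
rewrite chain_meanS.
have e0 : widen_ord (leqnSn n.+1) ord0 = ord0 by apply: val_inj.
have := vstep ord0 s; rewrite e0 => /le_trans; apply.
(* The row of [K] has mass 1, so the present cost can go under the sum; it then suffices to compare
   the terms for each next state [y]. *)
rewrite -[c ord0 s]mul1r -(K1 ord0 s) big_distrl -big_split /=.
apply: ler_sum => y _; rewrite -mulrDr; apply: ler_wpM2l => //.
under [X in chain_mean _ _ X]eq_fun => w.
  rewrite big_ord_recl ffun_cons0.
  under eq_bigr => i _ do rewrite ffun_consS.
  over.
rewrite chain_mean_cst_add // lerD2l.
apply: (IHn (fun i => K (lift ord0 i)) (fun i => c (lift ord0 i))
            (fun i => v (lift ord0 i))) => // [x|i x].
  by rewrite (_ : lift ord0 ord_max = ord_max) //; apply: val_inj.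
have := vstep (lift ord0 i) x.
by rewrite (_ : widen_ord _ _ = lift ord0 (widen_ord (leqnSn n) i)) //; apply: val_inj.
Qed.

(** [ord_pred] wraps around only at the first slot, where the indicator takes over; the moves are
    thus indexed by all slots but the last. *)
Lemma trajectory_sumE {R : comPzRingType} {S : finType} {n : nat} (N0 : (0 < n.+1)%N)
    (K : 'I_n.+1 -> S -> S -> R) (s : S) (G : {ffun 'I_n.+1 -> S} -> R) :
  \sum_(w : {ffun 'I_n.+1 -> S})
    (\prod_k (if k == Ordinal N0 then (w k == s)%:R
              else K (ord_pred k) (w (ord_pred k)) (w k))) * G w =
  chain_mean (fun i => K (widen_ord (leqnSn n) i)) s G.
Proof.
have -> : Ordinal N0 = ord0 by apply: val_inj.
apply: eq_bigr => w _; rewrite big_ord_recl eqxx; congr (_ * _ * _).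
apply: eq_bigr => i _; suff -> : ord_pred (lift ord0 i) = widen_ord (leqnSn n) i by [].
apply: val_inj => /=; rewrite /bump /= modnDr modn_small //; exact: leqW (ltn_ord i).
Qed.

Lemma le_trajectory_sum {R : numDomainType} {S : finType} {N : nat} (N0 : (0 < N)%N)
    (K : 'I_N -> S -> S -> R) (c v : 'I_N -> S -> R) (s : S) :
  (forall t x y, 0 <= K t x y) -> (forall t x, \sum_y K t x y = 1) ->
  (forall (t : 'I_N) x, t.+1 = N -> v t x <= c t x) ->
  (forall (t : 'I_N) x, (t.+1 < N)%N -> v t x <= c t x + \sum_y K t x y * v (ordS t) y) ->
  v (Ordinal N0) s <=
  \sum_(w : {ffun 'I_N -> S})
    (\prod_k (if k == Ordinal N0 then (w k == s)%:R
              else K (ord_pred k) (w (ord_pred k)) (w k))) * \sum_k c k (w k).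
Proof.
case: N N0 K c v => // n N0 K c v K0 K1 vlast vstep.
rewrite trajectory_sumE (_ : Ordinal N0 = ord0); last exact: val_inj.
apply: le_chain_mean => // [x|i x]; first exact: vlast.
have -> : lift ord0 i = ordS (widen_ord (leqnSn n) i).
  by apply: val_inj; rewrite /= modn_small // ltnS.
by apply: vstep; rewrite /= ltnS.
Qed.

(** A solution is a subsolution, and so is [- v] for the costs [- c]. *)
Lemma eq_trajectory_sum {R : numDomainType} {S : finType} {N : nat} (N0 : (0 < N)%N)
    (K : 'I_N -> S -> S -> R) (c v : 'I_N -> S -> R) (s : S) :
  (forall t x y, 0 <= K t x y) -> (forall t x, \sum_y K t x y = 1) ->
  (forall (t : 'I_N) x, t.+1 = N -> v t x = c t x) ->
  (forall (t : 'I_N) x, (t.+1 < N)%N -> v t x = c t x + \sum_y K t x y * v (ordS t) y) ->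
  \sum_(w : {ffun 'I_N -> S})
    (\prod_k (if k == Ordinal N0 then (w k == s)%:R
              else K (ord_pred k) (w (ord_pred k)) (w k))) * \sum_k c k (w k) =
  v (Ordinal N0) s.
Proof.
move=> K0 K1 vlast vstep; apply/le_anti/andP; split; last first.
  by apply: le_trajectory_sum => // t x tN; rewrite -?vstep // -vlast.
rewrite -lerN2 -sumrN.
under [X in _ <= X]eq_bigr => w _ do rewrite -mulrN -sumrN.
apply: (le_trajectory_sum N0 K (fun t x => - c t x) (fun t x => - v t x)) => // t x tN.
  by rewrite vlast.
under eq_bigr => y _ do rewrite mulrN.
by rewrite sumrN -opprD -vstep.
Qed.

(** * The transition kernel is stochastic on feasible actions *)

(** The fibers over [D] are finitely many, disjoint, and cover all but a null set. *)
Lemma sum_probability_fibers {d : measure_display} {T : measurableType d}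
    {R : realType} (P : probability T R) {U : choiceType} (D : {fset U})
    (f : T -> U) :
  (forall u, u \in D -> measurable [set x | f x = u]%classic) ->
  {ae P, forall x, f x \in D} ->
  \sum_(u : D) fine (P [set x | f x = val u]%classic) = 1.
Proof.
move=> mf fD.
pose F u := [set x | f x = u]%classic.
have mU : measurable (\bigcup_(u in [set` D]) F u)%classic.
  by apply: fin_bigcup_measurable => [|u]; [exact: finite_fset|exact: mf].
have PU : (P (\bigcup_(u in [set` D]) F u)%classic = 1)%E.
  rewrite -[X in P X]setCK probability_setC; last exact: measurableC.
  suff -> : (P (~` \bigcup_(u in [set` D]) F u)%classic = 0)%E by rewrite sube0.
  apply: measure_negligible; first exact: measurableC.
  apply: negligibleS fD => x /= nx fx; apply: nx.
  by exists (f x).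
apply: EFin_inj; rewrite -PU measure_fin_bigcup; last 3 first.
- exact: finite_fset.
- exact: trivIset_preimage1.
- exact: mf.
rewrite fsbig_finite ?finite_fset // set_fsetK -sumEFin big_seq_fsetE /=.
by apply: eq_bigr => u _; rewrite fineK // fin_num_measure //; exact: mf (valP u).
Qed.

(** The fiber of the capped update is a single point below [bmax m] and a half-line at [bmax m]: the
    two cases of the kernel. *)
Lemma battery_kernelE {R : realType} {m : params R} (n : 'I_(numDev m)) (h b p b' : R) :
  b' <= bmax m ->
  battery_kernel n h b p b' =
  fine (harvest n [set u | Num.min (b + u - energy n h p) (bmax m) = b']%classic).
Proof.
move=> b'max; rewrite /battery_kernel.
case: ltP => [b'lt|maxb']; congr (fine (harvest n _)); apply/seteqP; split => u /=.
- move=> ->; rewrite min_l; last by apply: ltW; lra.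
  lra.
- by rewrite /Order.min; case: ifPn => _ ub; lra.
- by move=> le_u; rewrite min_r; lra.
- by rewrite /Order.min; case: ifPn => [|/negPf ltu] ub; [|move: ltu; rewrite ltNge]; lra.
Qed.

Lemma battery_kernel_ge0 {R : realType} {m : params R} (n : 'I_(numDev m)) (h b p b' : R) :
  0 <= battery_kernel n h b p b'.
Proof. by rewrite /battery_kernel; case: ifP => _; apply: fine_ge0. Qed.

Lemma sum_battery_kernel {R : realType} {m : params R} (hB : battery_closed m)
    (n : 'I_(numDev m)) (i : 'I_(numGains m)) (b p : R) :
  b \in batteries m -> p \in powers n -> 0 <= energy n (gain i) p <= b ->
  \sum_(b' : batteries m) battery_kernel n (gain i) b p (val b') = 1.
Proof.
move=> bB pP eb; have := hB n i b p bB pP eb.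
set f := fun u : R => Num.min (b + u - energy n (gain i) p) (bmax m).
move=> fB; rewrite -(sum_probability_fibers (harvest n) (batteries m) f) //.
  apply: eq_bigr => b' _; apply: battery_kernelE.
  by have /andP[] := batteries_bound (valP b').
move=> u _; rewrite -[X in measurable X]setTI.
have mf : measurable_fun setT f.
  apply: measurable_minr; last exact: measurable_cst.
  apply: measurable_funB; last exact: measurable_cst.
  by apply: measurable_funD; [exact: measurable_cst|exact: measurable_id].
by apply: (mf measurableT [set u]%classic); exact: measurable_set1.
Qed.

Lemma transition_ge0 {R : realType} {m : params R} (s : state m) (p : action m)
    (s' : state m) : 0 <= Defs.kernel s p s'.
Proof.
by apply: prodr_ge0 => n _; rewrite mulr_ge0 ?psi_ge0 ?battery_kernel_ge0.
Qed.

Lemma sum_transition {R : realType} {m : params R} (hB : battery_closed m)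
    (s : state m) (p : action m) :
  constraintC2 s p -> \sum_s' Defs.kernel s p s' = 1.
Proof.
move=> /forallP C2; rewrite -(pair_bigA _ (fun i b => Defs.kernel s p (i, b))) /=.
(* The next batteries are summed first, as their law involves only the current channel. In both sums
   a sum of products over devices becomes a product of sums, each equal to 1. *)
under eq_bigr => i _.
  under eq_bigr => b _ do rewrite /Defs.kernel big_split /=.
  rewrite -big_distrr /= /battery -(bigA_distr_bigA (fun n (b : batteries m) =>
    battery_kernel n (channel s n) (val (s.2 n)) (power p n) (val b))).
  rewrite [X in _ * X]big1 ?mulr1 => [|n _]; last first.
    by apply: sum_battery_kernel => //; exact: valP.
  over.
rewrite -(bigA_distr_bigA (fun n j => psi n (s.1 n) j)) big1 // => n _.
exact: psi_sum1.
Qed.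

(** * Minima over feasible actions, and clamping of policies *)

Lemma min_feasible_le {R : realType} {m : params R} (s : state m) (f : action m -> R)
    (p : action m) : p \in feasible_actions s -> min_feasible s f <= f p.
Proof. by move=> ps; apply: bigmin_le_cond. Qed.

Lemma min_feasible_attained {R : realType} {m : params R} (s : state m)
    (f : action m -> R) :
  exists2 p, p \in feasible_actions s & min_feasible s f = f p.
Proof.
exists [arg min_(p < idle m | p \in feasible_actions s) f p]%O.
  by case: arg_minP => //; exact: idle_feasible.
rewrite /min_feasible; case: arg_minP => [|p ps pmin]; first exact: idle_feasible.
apply/le_anti; rewrite bigmin_le_cond //=.
by apply/bigmin_geP; split => //; exact: pmin (idle_feasible s).
Qed.

(* At an infeasible action the kernel need not have mass 1. *)
Definition clamp {R : realType} {m : params R} (pi : policy m) : policy m :=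
  fun t s => if pi t s \in feasible_actions s then pi t s else idle m.

Lemma clamp_feasible {R : realType} {m : params R} (pi : policy m) t s :
  clamp pi t s \in feasible_actions s.
Proof. by rewrite /clamp; case: ifP => // _; exact: idle_feasible. Qed.

Lemma step_prob_ge0 {R : realType} {m : params R} (pi : policy m) s1 w t :
  0 <= step_prob pi s1 w t.
Proof. by rewrite /step_prob; case: ifP => _; rewrite ?ler0n ?transition_ge0. Qed.

Lemma admissible_feasible {R : realType} {m : params R} (s1 : state m) (pi : policy m)
    (w : trajectory m) (t : slot m) :
  admissible s1 pi -> (forall k : slot m, (k <= t)%N -> step_prob pi s1 w k != 0) ->
  pi t (w t) \in feasible_actions (w t).
Proof.
move=> adm pos.
have [|C2 C3] := adm w t; last by rewrite inE C2 C3.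
by apply: prodr_gt0 => k kt; rewrite lt_neqAle eq_sym pos ?step_prob_ge0.
Qed.

Lemma trajectory_prob_clamp {R : realType} {m : params R} (s1 : state m)
    (pi : policy m) (w : trajectory m) :
  admissible s1 pi -> trajectory_prob (clamp pi) s1 w = trajectory_prob pi s1 w.
Proof.
move=> adm.
have [/forallP eqs|] := boolP [forall k, step_prob (clamp pi) s1 w k == step_prob pi s1 w k].
  by apply: eq_bigr => k _; exact/eqP.
rewrite negb_forall => /existsP[k0 nk0].
(* At the first slot where the two processes differ, pi was infeasible, so by
   admissibility the history up to there has probability 0 for both. *)
case: (@arg_minnP _ k0 (fun k => step_prob (clamp pi) s1 w k != step_prob pi s1 w k)
         (fun k : slot m => nat_of_ord k) nk0) => k nk kmin.
(* At the first slot the step probability is an indicator independent of the policy. *)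
have k_gt0 : (0 < k)%N.
  rewrite lt0n; apply: contra nk => /eqP kz.
  by rewrite /step_prob (_ : k = first_slot m) ?eqxx //; exact: val_inj.
have predk : (ord_pred k < k)%N.
  rewrite /= -{1}(prednK k_gt0) addSn /= modnDr modn_small ?prednK //.
  exact: ltnW (ltn_ord k).
(* Otherwise [pi] would be feasible at [ord_pred k], and the two step probabilities at [k] would
   agree. *)
have [j jk j0] : exists2 j : slot m, (j < k)%N & step_prob pi s1 w j = 0.
  apply/not_exists2P => nj; move/negP: nk; apply.
  rewrite /step_prob; case: ifP => // _.
  rewrite /clamp (admissible_feasible s1) // => i ik.
  by apply/eqP => i0; case: (nj i) => //; apply; exact: leq_ltn_trans ik predk.
(* By minimality of [k] the two processes agree at [j], so both products contain a zero factor. *)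
have cj0 : step_prob (clamp pi) s1 w j = 0.
  rewrite -j0; apply/eqP/negPn/negP => nj.
  by have := kmin j nj; rewrite leqNgt jk.
by rewrite /trajectory_prob [LHS](bigD1 j) // [RHS](bigD1 j) //= j0 cj0 !mul0r.
Qed.

(** On trajectories of nonzero probability [pi] is feasible at every slot, so clamping leaves its
    costs unchanged; the others contribute 0. *)
Lemma J_clamp {R : realType} {m : params R} (s1 : state m) (pi : policy m) :
  admissible s1 pi -> J (clamp pi) s1 = J pi s1.
Proof.
move=> adm; apply: eq_bigr => w _; rewrite trajectory_prob_clamp //.
have [-> | pos] := eqVneq (trajectory_prob pi s1 w) 0; first by rewrite !mul0r.
congr (_ * _); apply: eq_bigr => t _; rewrite /clamp (admissible_feasible s1) // => k _.
by move/prodf_neq0: pos; apply.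
Qed.

Theorem theorem2 (R : realType) (m : params R) (hB : battery_closed m)
    (V : slot m -> state m -> R)
    (hbellman : forall (t : slot m) (s : state m), (t.+1 < numSlots m)%N ->
       V t s = min_feasible s (fun p => cost s p + next_expectation (V (ordS t)) s p))
    (hterminal : forall (t : slot m) (s : state m), t.+1 = numSlots m ->
       V t s = min_feasible s (fun p => cost s p))
    (s1 : state m) :
  optimal_value s1 (V (first_slot m) s1).
Proof.
have sumK (pi : policy m) : (forall t s, pi t s \in feasible_actions s) ->
    forall t s, \sum_s' Defs.kernel s (pi t s) s' = 1.
  by move=> feas t s; apply: sum_transition => //; have := feas t s; rewrite inE => /andP[].
split; last first.
  (* Clamping makes every row of the transition kernel sum to 1, as the comparison requires. *)
  move=> pi adm; rewrite -(J_clamp s1 pi adm).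
  have feas := clamp_feasible pi.
  apply: (le_trajectory_sum (numSlots_gt0 m) (fun t s => Defs.kernel s (clamp pi t s))
           (fun t s => cost s (clamp pi t s)) V) => [t s s'|t s|t s tN|t s tN].
  - exact: transition_ge0.
  - exact: sumK.
  - by rewrite hterminal //; exact: min_feasible_le.
  - rewrite hbellman //.
    exact: (min_feasible_le s (fun p => cost s p + next_expectation (V (ordS t)) s p)).
(* V (ordS t) wraps around to the first slot at the last t, hence the test. *)
pose objective (t : slot m) s p := cost s p
  + (if (t.+1 < numSlots m)%N then next_expectation (V (ordS t)) s p else 0).
(* The optimal policy picks a minimizer of the objective in every state, so both Bellman
   inequalities become equalities. *)
pose pi t s := s2val (cid2 (min_feasible_attained s (objective t s))).
have feas t s : pi t s \in feasible_actions s by rewrite /pi; case: cid2.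
have opt t s : min_feasible s (objective t s) = objective t s (pi t s).
  by rewrite /pi; case: cid2.
exists pi.
  by move=> w t _; have := feas t (w t); rewrite inE => /andP[].
apply: (eq_trajectory_sum (numSlots_gt0 m) (fun t s => Defs.kernel s (pi t s))
         (fun t s => cost s (pi t s)) V) => [t s s'|t s|t s tN|t s tN].
- exact: transition_ge0.
- exact: sumK.
- rewrite hterminal //; have := opt t s; rewrite /objective tN ltnn addr0 => <-.
  by congr min_feasible; apply/funext => p; rewrite addr0.
- by rewrite hbellman //; have := opt t s; rewrite /objective tN.
Qed.
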